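(* Let $(\Omega,\mathcal A,\mu)$ be a probability space, $T:\Omega\to\Omega$ an invertible ergodic transformation preserving $\mu$, and $c:\Omega\to(0,+\infty)$ a random variable (no integrability is assumed on $c$ or $1/c$). For $\omega\in\Omega$ let $(X_n)_{n\ge 0}$ be the random walk on $\mathbb Z$ with $X_0=0$ in the conductance environment $(c(T^k\omega))_{k\in\mathbb Z}$, as defined in the context. Then for $\mu$-almost every $\omega$, $$\lim_{n\to+\infty}\frac{E_\omega(X_n^2)}{n}=\Bigl[\Bigl(\int_\Omega c\,d\mu\Bigr)\Bigl(\int_\Omega\frac1c\,d\mu\Bigr)\Bigr]^{-1},$$ where the right-hand side is understood to be $0$ as soon as one of the two integrals (or both) equals $+\infty$.
   Context: For fixed $\omega\in\Omega$, the edge $[k,k+1]$ of $\mathbb Z$ is given the conductance $c(T^k\omega)$. Put $\bar c=c+c\circ T^{-1}$, so $\bar c(T^k\omega)=c(T^k\omega)+c(T^{k-1}\omega)$. The random walk $(X_n)_{n\ge0}$ in the environment $\omega$ is the Markov chain on $\mathbb Z$ with $X_0=0$ and Markov operator $$P_\omega f(k)=\frac{1}{\bar c(T^k\omega)}\Bigl(c(T^{k-1}\omega)f(k-1)+c(T^k\omega)f(k+1)\Bigr),$$ i.e. from $k$ it jumps to $k-1$ with probability $c(T^{k-1}\omega)/\bar c(T^k\omega)$ and to $k+1$ with probability $c(T^k\omega)/\bar c(T^k\omega)$. $E_\omega$ denotes expectation with respect to the randomness of the chain, the environment $\omega$ being fixed. *)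

(* Defs.v *)
From HB Require Import structures.
From mathcomp Require Import all_boot all_order all_algebra.
From mathcomp Require Import all_classical all_reals all_analysis.

Set Implicit Arguments.
Unset Strict Implicit.
Unset Printing Implicit Defensive.

Import Order.TTheory GRing.Theory Num.Theory.
Import numFieldNormedType.Exports.

Local Open Scope classical_set_scope.
Local Open Scope ring_scope.

(* Invertibility is understood in the measurable category: [Tinv] is a
   two-sided, everywhere defined, measurable inverse of [T]. *)
Definition invertible_transformation (d : measure_display)
    (Omega : measurableType d) (T Tinv : Omega -> Omega) : Prop :=
  [/\ cancel T Tinv, cancel Tinv T,
      measurable_fun setT T & measurable_fun setT Tinv].

Definition measure_preserving (d : measure_display) (Omega : measurableType d)
    (R : realType) (mu : probability Omega R) (T : Omega -> Omega) : Prop :=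
  forall A : set Omega, measurable A -> mu (T @^-1` A) = mu A.

Definition ergodic (d : measure_display) (Omega : measurableType d)
    (R : realType) (mu : probability Omega R) (T : Omega -> Omega) : Prop :=
  forall A : set Omega, measurable A -> T @^-1` A = A ->
    mu A = 0%E \/ mu A = 1%E.

(* [T^k] for [k] in Z; [Negz n] is the integer [- n.+1]. *)
Definition iterz (A : Type) (T Tinv : A -> A) (k : int) : A -> A :=
  match k with
  | Posz n => iter n T
  | Negz n => iter n.+1 Tinv
  end.

Definition cbar (A : Type) (R : realType) (Tinv : A -> A) (c : A -> R)
    (omega : A) : R :=
  c omega + c (Tinv omega).

Definition walk_operator (A : Type) (R : realType) (T Tinv : A -> A)
    (c : A -> R) (omega : A) (f : int -> R) (k : int) : R :=
  (cbar Tinv c (iterz T Tinv k omega))^-1 *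
  (c (iterz T Tinv (k - 1) omega) * f (k - 1)
   + c (iterz T Tinv k omega) * f (k + 1)).

(* The state space is discrete, so [X n] being a random variable means that
   all its preimages are measurable. The Markov property is stated on
   cylinders; the one-step probability from [j] to [y] is [Q \1_[set y] j].
   It is in product form, so that cylinders of probability zero need no
   separate treatment. *)
Definition markov_chain (d : measure_display) (W : measurableType d)
    (R : realType) (P : probability W R) (Q : (int -> R) -> int -> R)
    (x0 : int) (X : nat -> W -> int) : Prop :=
  [/\ forall (n : nat) (B : set int), measurable (X n @^-1` B),
      P [set w | X 0%N w = x0] = 1%E &
      forall (n : nat) (x : nat -> int),
        P [set w | forall i, (i <= n.+1)%N -> X i w = x i] =
        (P [set w | forall i, (i <= n)%N -> X i w = x i]
         * (Q \1_[set x n.+1] (x n))%:E)%E].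

Definition limit_variance (d : measure_display) (Omega : measurableType d)
    (R : realType) (mu : probability Omega R) (c : Omega -> R) : \bar R :=
  let I := (\int[mu]_omega (c omega)%:E)%E in
  let J := (\int[mu]_omega ((c omega)^-1)%:E)%E in
  if (I == +oo%E) || (J == +oo%E) then 0%E else ((I * J)^-1)%E.

(* Main.v *)
Require Import Defs.
From mathcomp Require Import all_boot all_order all_algebra.
From mathcomp Require Import all_classical all_reals all_analysis.
From mathcomp Require Import measurable_realfun ring lra zify.
Import Order.TTheory GRing.Theory Num.Theory.
Import numFieldNormedType.Exports.
Local Open Scope classical_set_scope.
Local Open Scope ring_scope.

(** Write kappa_k = c(T^k omega).  The equation P_omega f = f + 1, f(0) = 0 is
    solved on Z by
      f(k) = sum_(0 <= j < k) (1 + (2 / kappa_j) * sum_(0 <= i < j) kappa_i)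
    for k >= 0 and by the mirror image for k < 0, so E_omega f(X_n) = n for
    every n.  By Birkhoff's theorem f(k) / k^2 tends to I * J, where I and J are
    the integrals of c and 1/c, whence n is close to I * J * E_omega(X_n^2) up
    to o(E_omega(X_n^2)) + O(1).  When I or J is infinite, truncating c and 1/c
    bounds f from below and gives f(k) / k^2 --> +oo. *)

(** The equation for f says that the flux kappa_k (f(k+1) - f(k)) grows by kappa_k + kappa_(k-1)
    across the site k, so f results from two summations. A multiple of the harmonic function
    vanishing at 0 could still be added; the normalisation f(1) = f(-1) = 1 fixes it and makes f
    nonnegative. Nonnegativity lets the identity for the expectation of f(X_n) be proved in [0, +oo]
    with no prior moment bound. The growth of f is expressed by inequalities between k^2 and s f(k),
    up to an additive constant and valid at every k, because these pass directly to expectations: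
    each s on one side of the limit gives one linear bound on the second moment. *)

(** * Deterministic growth of double sums under Cesaro convergence *)

Section QuadraticGrowth.
Variable R : realType.
Implicit Types (u r g h : nat -> R).

(* Cesaro convergence of [u] to [a], with an affine error bound valid for every
   [n] so that no division by [n] is needed. *)
Definition has_mean u (a : R) : Prop :=
  forall e : R, 0 < e -> exists C : R, forall n : nat,
    `|\sum_(i < n) u i - a * n%:R| <= e * n%:R + C.

Definition subquadratic g : Prop :=
  forall e : R, 0 < e -> exists C : R, forall n : nat,
    `|g n| <= e * n%:R ^+ 2 + C.

Lemma affine_le_quadratic (A B e : R) : 0 < e ->
  exists C : R, forall x : R, A * x + B <= e * x ^+ 2 + C.
Proof.
(* The constant comes from completing the square. *)
move=> e0; exists (B + A ^+ 2 / (4 * e)) => x.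
have -> : e * x ^+ 2 + (B + A ^+ 2 / (4 * e)) =
  e * (x - A / (2 * e)) ^+ 2 + (A * x + B) by field; rewrite gt_eqF.
by rewrite lerDr mulr_ge0 ?sqr_ge0 // ltW.
Qed.

Lemma subquadraticD g h :
  subquadratic g -> subquadratic h -> subquadratic (fun n => g n + h n).
Proof.
move=> sg sh e e0; have e2 : 0 < e / 2 by rewrite divr_gt0.
have [C HC] := sg _ e2; have [D HD] := sh _ e2.
exists (C + D) => n; apply: (le_trans (ler_normD _ _)).
apply: (le_trans (lerD (HC n) (HD n))); lra.
Qed.

Lemma subquadraticZ (a : R) g :
  subquadratic g -> subquadratic (fun n => a * g n).
Proof.
move=> sg e e0; have a0 : 0 < `|a| + 1 by rewrite ltr_wpDl.
have [C HC] := sg _ (divr_gt0 e0 a0); exists (`|a| * C) => n.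
rewrite normrM; apply: (le_trans (ler_wpM2l (normr_ge0 a) (HC n))).
rewrite mulrDr lerD2r mulrA ler_wpM2r ?sqr_ge0 //.
by rewrite mulrA ler_pdivrMr // mulrC ler_pM2l // lerDl.
Qed.

Lemma subquadratic_le_affine g (A B : R) :
  (forall n, `|g n| <= A * n%:R + B) -> subquadratic g.
Proof.
move=> gAB e e0; have [C HC] := affine_le_quadratic A B e e0.
by exists C => n; apply: le_trans (gAB n) (HC _).
Qed.

Lemma has_mean_le_affine u a : has_mean u a ->
  exists C : R, forall n : nat, `|\sum_(i < n) u i| <= (`|a| + 1) * n%:R + C.
Proof.
move=> /(_ 1 ltr01)[C HC]; exists C => n.
rewrite -[X in `|X|](subrK (a * n%:R)); apply: (le_trans (ler_normD _ _)).
by rewrite normrM (ger0_norm (ler0n _ n)); have := HC n; lra.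
Qed.

(** Evaluating the bound at [n = 0] shows that its constant is nonnegative. *)
Lemma has_mean_ge0 u a e : has_mean u a -> 0 < e ->
  exists2 C : R, 0 <= C & forall n : nat,
    `|\sum_(i < n) u i - a * n%:R| <= e * n%:R + C.
Proof.
move=> /[apply] -[C HC]; exists C => //.
by have := HC 0%N; rewrite big_ord0 !mulr0 subr0 normr0 add0r.
Qed.

(** Summation by parts, which reduces index weights to plain partial sums. *)
Lemma sum_mul_index r k :
  \sum_(j < k) r j * j%:R =
  k%:R * (\sum_(j < k) r j) - \sum_(j < k) r j - \sum_(j < k) \sum_(i < j) r i.
Proof.
elim: k => [|k IH]; first by rewrite !big_ord0 mulr0 !subr0.
by rewrite !big_ord_recr /= IH -natr1; ring.
Qed.

Lemma sum_index k : \sum_(j < k) (j%:R : R) = (k%:R ^+ 2 - k%:R) / 2.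
Proof.
elim: k => [|k IH]; first by rewrite big_ord0; field.
by rewrite big_ord_recr /= IH -natr1; field.
Qed.

Lemma has_mean_mul_index r b : has_mean r b ->
  subquadratic (fun n => n%:R * (\sum_(j < n) r j - b * n%:R)).
Proof.
move=> rb e e0; have e2 : 0 < e / 2 by rewrite divr_gt0.
have [C HC] := rb _ e2; have [D HD] := affine_le_quadratic C 0 _ e2.
exists D => n; rewrite normrM ger0_norm //.
apply: (le_trans (ler_wpM2l (ler0n _ n) (HC n))).
have := HD n%:R; lra.
Qed.

Lemma has_mean_sum r b : has_mean r b ->
  subquadratic (fun n => \sum_(j < n) (\sum_(i < j) r i - b * j%:R)).
Proof.
move=> rb e e0; have e2 : 0 < e / 2 by rewrite divr_gt0.
have [C _ HC] := has_mean_ge0 _ _ _ rb e2.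
have [D HD] := affine_le_quadratic C 0 _ e2.
exists D => n; apply: (le_trans (ler_norm_sum _ _ _)).
apply: (@le_trans _ _ (\sum_(j < n) (e / 2 * n%:R + C))).
  apply: ler_sum => j _; apply: (le_trans (HC j)).
  by rewrite lerD2r ler_pM2l // ler_nat ltnW.
rewrite sumr_const card_ord -mulr_natr.
have := HD n%:R; lra.
Qed.

(** After summation by parts the terms [n * S_n] and the sum of the [S_j] contribute [b * n^2] and
    [b * n^2 / 2]; everything else is at most linear. *)
Lemma weighted_index_growth r b : has_mean r b ->
  subquadratic (fun n => \sum_(j < n) r j * j%:R - b / 2 * n%:R ^+ 2).
Proof.
move=> rb; have [C HC] := has_mean_le_affine _ _ rb.
have -> : (fun n => \sum_(j < n) r j * j%:R - b / 2 * n%:R ^+ 2) =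
  (fun n => n%:R * (\sum_(j < n) r j - b * n%:R)
     + ((-1) * (\sum_(j < n) (\sum_(i < j) r i - b * j%:R))
        + (b / 2 * n%:R - \sum_(j < n) r j))).
  apply/funext => n; rewrite sum_mul_index sumrB -mulr_sumr sum_index.
  by field.
apply: subquadraticD; first exact: has_mean_mul_index.
apply: subquadraticD; first by apply: subquadraticZ; exact: has_mean_sum.
apply: (@subquadratic_le_affine _ (`|b / 2| + (`|b| + 1)) C) => n.
apply: (le_trans (ler_normB _ _)); rewrite normrM (ger0_norm (ler0n _ n)).
have := HC n; lra.
Qed.

(** The inner sum is replaced by [a * j]. The error at [j] is a small multiple of [j] plus a
    constant, and the nonnegative weights [r j] have total mass at most linear in [n]. *)
Lemma weighted_sum_growth u r a b : (forall j, 0 <= r j) ->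
  has_mean u a -> has_mean r b ->
  subquadratic (fun n =>
    \sum_(j < n) r j * \sum_(i < j) u i - a * b / 2 * n%:R ^+ 2).
Proof.
move=> r0 ua rb.
have -> : (fun n => \sum_(j < n) r j * \sum_(i < j) u i
                    - a * b / 2 * n%:R ^+ 2) =
  (fun n => \sum_(j < n) r j * (\sum_(i < j) u i - a * j%:R)
     + a * (\sum_(j < n) r j * j%:R - b / 2 * n%:R ^+ 2)).
  apply/funext => n; rewrite mulrBr !mulrA addrA; congr (_ - _).
  rewrite mulr_sumr -big_split /=; apply: eq_bigr => j _; ring.
apply: subquadraticD; last exact/subquadraticZ/weighted_index_growth.
move=> e e0; have [C HC] := has_mean_le_affine _ _ rb.
set B := `|b| + 1 in HC; have B0 : 0 < B by rewrite ltr_wpDl.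
(* The total weight is at most [B * n + C], so this tolerance turns the leading term of the product
   into [e / 2 * n^2]. *)
have e1 : 0 < e / (2 * B) by rewrite divr_gt0 // mulr_gt0.
have e2 : 0 < e / 2 by rewrite divr_gt0.
have [D D0 HD] := has_mean_ge0 _ _ _ ua e1.
have [E HE] := affine_le_quadratic (e / (2 * B) * C + D * B) (D * C) _ e2.
exists E => n; apply: (le_trans (ler_norm_sum _ _ _)).
apply: (@le_trans _ _ (\sum_(j < n) r j * (e / (2 * B) * n%:R + D))).
  apply: ler_sum => j _; rewrite normrM ger0_norm // ler_wpM2l //.
  apply: (le_trans (HD j)).
  by rewrite lerD2r ler_pM2l // ler_nat ltnW.
rewrite -mulr_suml.
apply: (@le_trans _ _ ((B * n%:R + C) * (e / (2 * B) * n%:R + D))).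
  apply: ler_wpM2r; first by rewrite addr_ge0 // mulr_ge0 // ltW.
  exact: le_trans (ler_norm _) (HC n).
have -> : (B * n%:R + C) * (e / (2 * B) * n%:R + D) =
  e / 2 * n%:R ^+ 2 + ((e / (2 * B) * C + D * B) * n%:R + D * C).
  by field; rewrite gt_eqF.
have := HE n%:R; lra.
Qed.

(** Here [u] lists the conductances met when walking away from 0 in one direction, so one formula
    serves both half-lines. *)
Definition walk_potential u (k : nat) : R :=
  \sum_(j < k) (1 + 2 * ((u j)^-1 * \sum_(i < j) u i)).

Lemma walk_potential_ge0 u k : (forall j, 0 < u j) -> 0 <= walk_potential u k.
Proof.
move=> u0; apply: sumr_ge0 => j _; rewrite addr_ge0 // !mulr_ge0 //.
  by rewrite invr_ge0 ltW.
by apply: sumr_ge0 => i _; exact: ltW.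
Qed.

Lemma walk_potential_growth u a b : (forall j, 0 < u j) ->
  has_mean u a -> has_mean (fun j => (u j)^-1) b ->
  subquadratic (fun n => walk_potential u n - a * b * n%:R ^+ 2).
Proof.
move=> u0 ua rb.
have -> : (fun n => walk_potential u n - a * b * n%:R ^+ 2) =
  (fun n => n%:R + 2 * (\sum_(j < n) (u j)^-1 * \sum_(i < j) u i
                        - a * b / 2 * n%:R ^+ 2)).
  apply/funext => n; rewrite /walk_potential big_split /= sumr_const card_ord.
  by rewrite -mulr_sumr; field.
apply: subquadraticD.
  by apply: (@subquadratic_le_affine _ 1 0) => n; rewrite ger0_norm // mul1r addr0.
have r0 j : 0 <= (u j)^-1 by rewrite invr_ge0 ltW.
exact: subquadraticZ (weighted_sum_growth _ _ _ _ r0 ua rb).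
Qed.

(** Meant for truncations: [v] and [r] minorise [u] and its inverse independently and have finite
    means even when [u] or its inverse has none. The double sum is monotone in both factors. *)
Lemma walk_potential_lower u v r a b : (forall j, 0 < u j) ->
  (forall j, 0 <= v j <= u j) -> (forall j, 0 <= r j <= (u j)^-1) ->
  has_mean v a -> has_mean r b ->
  forall e : R, 0 < e -> exists C : R, forall n : nat,
    (a * b - e) * n%:R ^+ 2 <= walk_potential u n + C.
Proof.
move=> u0 vu ru va rb e e0; have e2 : 0 < e / 2 by rewrite divr_gt0.
have r0 j : 0 <= r j by case/andP: (ru j).
have [C HC] := weighted_sum_growth _ _ _ _ r0 va rb _ e2.
exists (2 * C) => n.
have : \sum_(j < n) r j * \sum_(i < j) v i <=
       \sum_(j < n) (u j)^-1 * \sum_(i < j) u i.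
  apply: ler_sum => j _; apply: ler_pM => //.
  - by apply: sumr_ge0 => i _; case/andP: (vu i).
  - by case/andP: (ru j).
  - by apply: ler_sum => i _; case/andP: (vu i).
have -> : walk_potential u n = n%:R + 2 * \sum_(j < n) (u j)^-1 * \sum_(i < j) u i.
  by rewrite /walk_potential big_split /= sumr_const card_ord -mulr_sumr.
have := HC n; rewrite ler_norml => /andP[+ _].
have := ler0n R n; lra.
Qed.

End QuadraticGrowth.

Arguments has_mean {R} u a.
Arguments walk_potential {R} u k.

(** * Ergodic sums of a function with negative integral *)

Section Birkhoff.
Variables (R : realType) (d : measure_display) (Omega : measurableType d).
Variables (mu : probability Omega R) (T : Omega -> Omega).
Hypothesis mT : measurable_fun setT T.
Hypothesis T_mp : measure_preserving mu T.
Hypothesis T_erg : ergodic mu T.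

Lemma ge0_integral_preserving (f : Omega -> \bar R) :
  measurable_fun setT f -> (forall x, 0 <= f x)%E ->
  (\int[mu]_x f (T x) = \int[mu]_x f x)%E.
Proof.
move=> mf f0.
rewrite -[LHS](@ge0_integral_pushforward _ _ _ _ R T mT mu setT f) //.
by apply: eq_measure_integral => A mA _; exact: T_mp.
Qed.

Lemma integrable_preserving (f : Omega -> \bar R) :
  mu.-integrable setT f -> mu.-integrable setT (f \o T).
Proof.
move=> /integrableP[mf fi]; apply/integrableP; split.
  exact: measurableT_comp.
by rewrite (ge0_integral_preserving (fun x => `|f x|%E)) //;
  exact: measurableT_comp.
Qed.

Lemma integral_preserving (f : Omega -> \bar R) :
  mu.-integrable setT f -> (\int[mu]_x f (T x) = \int[mu]_x f x)%E.
Proof.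
move=> fi; have [mf _] := integrableP _ _ _ fi.
rewrite -[LHS](@integral_pushforward _ _ _ _ R T mT mu setT f) //.
- by apply: eq_measure_integral => A mA _; exact: T_mp.
- exact: integrable_preserving.
Qed.

(* The maximum of the ergodic sums of lengths [1, .., n + 1]. *)
Fixpoint max_ergodic_sum (g : Omega -> R) (n : nat) (x : Omega) : R :=
  if n is n'.+1 then g x + Num.max 0 (max_ergodic_sum g n' (T x)) else g x.

Variable g : Omega -> R.
Hypothesis gi : mu.-integrable setT (EFin \o g).
Let M := max_ergodic_sum g.

Lemma max_ergodic_sumS n x : M n x <= M n.+1 x.
Proof.
elim: n x => [|n IH] x; first by rewrite /= lerDl le_max lexx.
by rewrite /M /= lerD2l ge_max !le_max lexx /= IH orbT.
Qed.

Lemma max_ergodic_sum_ge n x : g x <= M n x.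
Proof. by case: n => [|n] //=; rewrite lerDl le_max lexx. Qed.

Lemma ergodic_sum_le_max n x : \sum_(i < n.+1) g (iter i T x) <= M n x.
Proof.
elim: n x => [|n IH] x; first by rewrite big_ord_recr big_ord0 /= add0r.
rewrite big_ord_recl /= lerD2l le_max; apply/orP; right.
apply: le_trans (IH (T x)); rewrite le_eqVlt; apply/orP; left; apply/eqP.
by apply: eq_bigr => i _; rewrite /bump /= -iterS iterSr.
Qed.

Lemma integrable_max_ergodic_sum n : mu.-integrable setT (EFin \o M n).
Proof.
elim: n => [|n IH] //.
have -> : EFin \o M n.+1 =
    ((EFin \o g) \+ ((EFin \o M n) \o T)^\+)%E.
  by apply/funext => x /=; rewrite funeposE EFinD EFin_max maxC.
apply: integrableD => //.
apply: integrable_funepos; first exact: measurableT.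
exact: integrable_preserving IH.
Qed.

(** Thresholds are natural numbers, so that the set is a countable intersection. Its invariance is
    exact and not merely almost sure, as [ergodic] demands. *)
Definition unbounded_sums : set Omega :=
  [set x | forall N : nat, exists n, N%:R < M n x].

Lemma unbounded_sums_invariant : T @^-1` unbounded_sums = unbounded_sums.
Proof.
apply/seteqP; split => x /=.
  move=> ub N; have [n Hn] := ub (Num.trunc (`|N%:R - g x|)).+1.
  exists n.+1; rewrite /M /= -ltrBlDl lt_max; apply/orP; right.
  apply: lt_trans Hn; apply: le_lt_trans (ler_norm _) _.
  by rewrite truncnS_gt.
(* Exceeding [N + |g x|] leaves more than [N >= 0] after removing the first term [g x], so the
   maximum with 0 must be attained by the sums started at [T x]. *)
move=> ub N; have [n Hn] := ub (Num.trunc (N%:R + `|g x|)).+1.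
have {}Hn : N%:R + `|g x| < M n x.
  by apply: lt_trans Hn; rewrite truncnS_gt.
exists n; have := lt_le_trans Hn (max_ergodic_sumS n x).
rewrite /M /= -ltrBlDl lt_max => H.
have N0 : N%:R <= N%:R + `|g x| - g x by rewrite -addrA lerDl subr_ge0 ler_norm.
case/orP: H => H; last exact: le_lt_trans N0 H.
by have := le_lt_trans N0 H; rewrite ltrn0.
Qed.

Lemma measurable_unbounded_sums : measurable unbounded_sums.
Proof.
have -> : unbounded_sums = \bigcap_N \bigcup_n (M n @^-1` `]N%:R, +oo[%classic).
  apply/seteqP; split => x /=.
    by move=> ub N _; have [n Hn] := ub N; exists n => //=; rewrite in_itv /= andbT.
  by move=> ub N; have [n _ /=] := ub N I; rewrite in_itv /= andbT => Hn; exists n.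
apply: bigcap_measurable => // N _; apply: bigcup_measurable => n _.
rewrite -[X in measurable X]setTI.
have /measurable_EFinP mM := measurable_int mu (integrable_max_ergodic_sum n).
by apply: mM => //; exact: measurable_itv.
Qed.

(* [M n.+1 - M n \o T = g + max (- M n \o T) 0] has a nonnegative integral, since
   [M n <= M n.+1] and [T] preserves [mu], and it tends to [g] wherever [M]
   is unbounded. *)
Lemma integral_ge0_of_unbounded_sums :
  mu unbounded_sums = 1%E -> (0 <= \int[mu]_x (g x)%:E)%E.
Proof.
move=> A1.
pose h n x : \bar R := ((M n.+1 x)%:E - (M n (T x))%:E)%E.
have Mi n : mu.-integrable setT (EFin \o M n) by exact: integrable_max_ergodic_sum.
have MTi n := integrable_preserving _ (Mi n).
have h0 n : (0 <= \int[mu]_x h n x)%E.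
  rewrite integralB_EFin //; last exact: MTi.
  rewrite (integral_preserving _ (Mi n)) sube_ge0; last first.
    by rewrite (integrable_fin_num measurableT (Mi n.+1)) ?orbT.
  apply: (le_integral measurableT (Mi n) (Mi n.+1)) => x _.
  by rewrite lee_fin max_ergodic_sumS.
have hE n x : h n x = (g x + Num.max (- M n (T x)) 0)%:E.
  rewrite /h -EFinB; congr EFin; rewrite /M /= -addrA; congr (_ + _).
  by rewrite maxr_absE maxr_absE; rewrite !sub0r !add0r subr0 normrN; field.
have gai : mu.-integrable setT (abse \o (EFin \o g)) by exact: integrable_abse.
have gTai := integrable_preserving _ gai.
(* Since [M n >= g], the correction [max (- M n (T x)) 0] is at most [|g (T x)|]; this gives the
   integrable majorant. *)
have [|||||_ _ cvgh] := @dominated_convergence _ _ _ mu setT measurableT h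
   (EFin \o g) ((abse \o (EFin \o g)) \+ ((abse \o (EFin \o g)) \o T))%E.
- move=> n; apply: emeasurable_funB; first exact: (measurable_int mu (Mi n.+1)).
  exact: (measurable_int mu (MTi n)).
- exact: (measurable_int mu gi).
- have : mu (~` unbounded_sums) = 0%E.
    rewrite probability_setC; last exact: measurable_unbounded_sums.
    by rewrite A1 subee.
  move=> N0; exists (~` unbounded_sums); split => //.
    exact/measurableC/measurable_unbounded_sums.
  move=> x /= nP Ax; apply: nP => _.
  have : unbounded_sums (T x).
    by move: Ax; rewrite -{1}unbounded_sums_invariant.
  move=> /(_ 0%N)[n0 Hn0]; apply: cvg_near_cst.
  exists n0 => // n /= n0n; rewrite hE; congr EFin.
  rewrite max_r ?addr0 // oppr_le0; apply: ltW (lt_le_trans Hn0 _).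
  elim: n n0n => [|n IH]; first by rewrite leqn0 => /eqP ->.
  rewrite leq_eqVlt => /orP[/eqP <- //|]; rewrite ltnS => /IH /le_trans; apply.
  exact: max_ergodic_sumS.
- exact: integrableD.
- apply: aeW => x n _; rewrite hE /= lee_fin.
  apply: (le_trans (ler_normD _ _)); rewrite lerD2l.
  rewrite ger0_norm ?le_max ?lexx ?orbT // ge_max normr_ge0 andbT.
  rewrite lerNl; apply: le_trans (max_ergodic_sum_ge n (T x)).
  by rewrite lerNl -normrN ler_norm.
- rewrite -(cvg_lim _ cvgh) //; apply: lime_ge.
    by apply/cvg_ex; eexists; exact: cvgh.
  by apply: nearW => n; exact: h0.
Qed.

(** By ergodicity the sums are unbounded above with probability 0 or 1, and probability 1 would
    force a nonnegative integral. *)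
Lemma ergodic_sum_bounded_above : (\int[mu]_x (g x)%:E < 0)%E ->
  \forall x \ae mu, exists C : R, forall n, \sum_(i < n) g (iter i T x) <= C.
Proof.
move=> g0.
have [A0|A1] := T_erg _ measurable_unbounded_sums unbounded_sums_invariant.
  exists unbounded_sums; split => //; first exact: measurable_unbounded_sums.
  move=> x /= nP; apply: contrapT => /existsNP[N HN]; apply: nP.
  exists N%:R => -[|n]; first by rewrite big_ord0.
  apply: le_trans (ergodic_sum_le_max n x) _; rewrite leNgt; apply/negP => H.
  by apply: HN; exists n.
by move: g0; rewrite ltNge integral_ge0_of_unbounded_sums.
Qed.

End Birkhoff.

(** * Pointwise ergodic theorem for integrable functions *)

Section BirkhoffMean.
Variables (R : realType) (d : measure_display) (Omega : measurableType d).
Variables (mu : probability Omega R) (T : Omega -> Omega).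
Hypothesis mT : measurable_fun setT T.
Hypothesis T_mp : measure_preserving mu T.
Hypothesis T_erg : ergodic mu T.

(** Subtracting [a + e] from [g] leaves a function of integral [- e < 0], whose ergodic sums are
    bounded above. *)
Lemma ergodic_sum_upper (g : Omega -> R) (a e : R) :
  mu.-integrable setT (EFin \o g) -> (\int[mu]_x (g x)%:E = a%:E)%E -> 0 < e ->
  \forall x \ae mu, exists C : R, forall n : nat,
    \sum_(i < n) g (iter i T x) - a * n%:R <= e * n%:R + C.
Proof.
move=> gi ga e0.
have ci : mu.-integrable setT (EFin \o cst (a + e)).
  exact: finite_measure_integrable_cst.
have hi : mu.-integrable setT (EFin \o (fun x => g x - (a + e))).
  exact: (integrableB measurableT gi ci).
have := @ergodic_sum_bounded_above R d Omega mu T mT T_mp T_erg _ hi.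
under eq_integral do rewrite EFinB.
rewrite integralB_EFin // ga integral_cst //.
rewrite [X in (_ * X)%E](_ : _ = 1%E) ?mule1; last exact: probability_setT.
rewrite -EFinB lte_fin => /(_ ltac:(lra)).
apply: filterS => x [C HC]; exists C => n; have := HC n.
by rewrite sumrB sumr_const card_ord -mulr_natr; lra.
Qed.

Lemma birkhoff_mean (g : Omega -> R) (a : R) :
  mu.-integrable setT (EFin \o g) -> (\int[mu]_x (g x)%:E = a%:E)%E ->
  \forall x \ae mu, has_mean (fun i => g (iter i T x)) a.
Proof.
move=> gi ga.
have gNi : mu.-integrable setT (EFin \o (fun x => - g x)).
  exact: (integrableN gi).
have gNa : (\int[mu]_x (- g x)%:E = (- a)%:E)%E.
  under eq_integral do rewrite EFinN.
  by rewrite integralN ?ga //; exact: integrable_add_def.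
(* Countably many tolerances suffice, and they share one null set. Applying the upper bound to [- g]
   as well gives both sides. *)
pose eps (m : nat) : R := m.+1%:R^-1.
have eps0 m : 0 < eps m by rewrite invr_gt0.
have H1 := ae_foralln (fun m => ergodic_sum_upper g a _ gi ga (eps0 m)).
have H2 := ae_foralln (fun m => ergodic_sum_upper _ _ _ gNi gNa (eps0 m)).
move: H1 H2; apply: filterS2 => x H1 H2 e e0.
pose m := Num.trunc e^-1.
have me : eps m <= e.
  rewrite /eps -[leRHS]invrK lef_pV2 ?posrE ?invr_gt0 //.
  exact/ltW/truncnS_gt.
have [C HC] := H1 m; have [D HD] := H2 m.
exists (`|C| + `|D|) => n.
have men : eps m * n%:R <= e * n%:R by rewrite ler_wpM2r.
have := HC n; have := HD n; rewrite sumrN ler_norml.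
have := ler_norm C; have := ler_norm D; have := normr_ge0 C; have := normr_ge0 D.
by move=> ? ? ? ? ? ?; apply/andP; split; lra.
Qed.

End BirkhoffMean.

(** * Expectations along a nearest-neighbour Markov chain *)

Section NearestNeighbourChain.
Variables (R : realType) (d : measure_display) (W : measurableType d).
Variable P : probability W R.

Lemma integral_affine (h : W -> R) (s C : R) :
  measurable_fun setT h -> (forall w, 0 <= h w) -> 0 <= s -> 0 <= C ->
  (\int[P]_w (s * h w + C)%:E = s%:E * \int[P]_w (h w)%:E + C%:E)%E.
Proof.
move=> mh h0 s0 C0; have mEh : measurable_fun setT (EFin \o h) by exact/measurable_EFinP.
under eq_integral do rewrite EFinD EFinM.
rewrite ge0_integralD //; last 2 first.
- by move=> w _; rewrite -EFinM lee_fin mulr_ge0.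
- exact: measurable_funeM.
rewrite ge0_integralZl_EFin //; last by move=> w _; rewrite lee_fin.
rewrite integral_cst // [X in (_ + _ * X)%E](_ : _ = 1%E) ?mule1 //.
exact: probability_setT.
Qed.

Variables (Q : (int -> R) -> int -> R) (l r : int -> R).
Hypothesis QE : forall f k, Q f k = l k * f (k - 1) + r k * f (k + 1).
Hypothesis l_ge0 : forall k, 0 <= l k.
Hypothesis r_ge0 : forall k, 0 <= r k.
Hypothesis lr1 : forall k, l k + r k = 1.
Variables (x0 : int) (X : nat -> W -> int).
Hypothesis mcX : markov_chain P Q x0 X.

Let mX n B : measurable (X n @^-1` B).
Proof. by case: mcX. Qed.

Lemma measurable_chain_fun (g : int -> R) n :
  measurable_fun setT (fun w => g (X n w)).
Proof. by move=> _ Y _; rewrite setTI; exact: (mX n (g @^-1` Y)). Qed.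

Let measurable_chain_EFin (g : int -> R) n (A : set W) :
  measurable_fun A (fun w => (g (X n w))%:E).
Proof.
apply: (measurable_funS measurableT) => //.
exact/measurable_EFinP/measurable_chain_fun.
Qed.

Definition cylinder n (x : nat -> int) : set W :=
  [set w | forall i, (i <= n)%N -> X i w = x i].

Lemma measurable_cylinder n x : measurable (cylinder n x).
Proof.
have -> : cylinder n x =
    \bigcap_i (if (i <= n)%N then X i @^-1` [set x i] else setT).
  apply/seteqP; split => w /=.
    by move=> H i _; case: ifPn => // /H.
  by move=> H i ni; have := H i I; rewrite ni.
by apply: bigcap_measurable => // i _; case: ifP.
Qed.

Lemma cylinder_step n x y :
  P (cylinder n x `&` X n.+1 @^-1` [set y]) =
  (P (cylinder n x) * (Q \1_[set y] (x n))%:E)%E.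
Proof.
have [_ _ /(_ n (fun i => if (i <= n)%N then x i else y))] := mcX.
rewrite ltnn leqnn => H.
rewrite (_ : _ `&` _ =
  [set w | forall i, (i <= n.+1)%N -> X i w = if (i <= n)%N then x i else y]).
  rewrite H; congr (P _ * _)%E; apply/seteqP.
  by split => w /= H' i ni; have := H' i ni; rewrite ni.
apply/seteqP; split => w /=.
  move=> [Hw Hy] i; rewrite leq_eqVlt => /orP[/eqP ->|]; first by rewrite ltnn.
  by rewrite ltnS => ni; rewrite ni; exact: Hw.
move=> Hw; split; first by move=> i ni; rewrite Hw ?ni // leqW.
by rewrite Hw // ltnn.
Qed.

Lemma transition_left k : Q \1_[set k - 1] k = l k.
Proof.
rewrite QE !indicE !in_set1 eqxx (_ : k + 1 == k - 1 = false); last by lia.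
by rewrite mulr1 mulr0 addr0.
Qed.

Lemma transition_right k : Q \1_[set k + 1] k = r k.
Proof.
rewrite QE !indicE !in_set1 eqxx (_ : k - 1 == k + 1 = false); last by lia.
by rewrite mulr1 mulr0 add0r.
Qed.

(** The two neighbours of [x n] carry conditional probabilities [l] and [r] of total 1, so the part
    of the cylinder where [X n.+1] is elsewhere is null. *)
Lemma cylinder_integral_step n x (g : int -> R) : (forall k, 0 <= g k) ->
  (\int[P]_(w in cylinder n x) (g (X n.+1 w))%:E =
   \int[P]_(w in cylinder n x) (Q g (X n w))%:E)%E.
Proof.
move=> g0; set A := cylinder n x; set k := x n.
have mA : measurable A by exact: measurable_cylinder.
pose B y := A `&` X n.+1 @^-1` [set y].
have mB y : measurable (B y) by exact: measurableI.
have PB y : P (B y) = (P A * (Q \1_[set y] k)%:E)%E by exact: cylinder_step.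
have intB y : (\int[P]_(w in B y) (g (X n.+1 w))%:E = (g y)%:E * P (B y))%E.
  rewrite -integral_cst //; apply: eq_integral => w.
  by rewrite inE => -[_ /= ->].
have dB : [disjoint B (k - 1) & B (k + 1)].
  apply/eqP; rewrite -subset0 => w [[_ /= E1] [_ /= E2]]; move: E2; rewrite E1; lia.
pose C := B (k - 1) `|` B (k + 1).
have mC : measurable C by exact: measurableU.
have CA : C `<=` A by move=> w [[]|[]].
have PA : P A \is a fin_num by exact: fin_num_measure.
have PC : P C = P A.
  have -> : P C = (P (B (k - 1)%R) + P (B (k + 1)%R))%E.
    by apply: measureU => //; exact/eqP.
  rewrite !PB transition_left transition_right -(fineK PA) -!EFinM -EFinD.
  by rewrite -mulrDr lr1 mulr1.
have PN : P (A `\` C) = 0%E.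
  have -> : P (A `\` C) = (P A - P (A `&` C))%E.
    by apply: measureD => //; rewrite ltey_eq PA.
  by rewrite (setIidr CA) PC subee.
rewrite -{1}(setDUK CA) ge0_integral_setU //; first last.
- by apply/eqP; rewrite setDIK.
- by move=> w _; rewrite lee_fin.
- exact: measurableD.
rewrite [X in (_ + X)%E]null_set_integral ?adde0 //; last exact: measurableD.
rewrite ge0_integral_setU //; last by move=> w _; rewrite lee_fin.
rewrite !intB !PB transition_left transition_right.
have -> : (\int[P]_(w in A) (Q g (X n w))%:E = (Q g k)%:E * P A)%E.
  rewrite -integral_cst //; apply: eq_integral => w.
  by rewrite inE => Aw; rewrite /= (Aw n (leqnn n)).
by rewrite QE -(fineK PA) -!EFinM -EFinD; congr EFin; ring.
Qed.

(* The cylinders of length [n + 1] form a countable partition of [W], indexed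
   here by the codes of the possible trajectories. *)
Lemma chain_integral_step n (g : int -> R) : (forall k, 0 <= g k) ->
  (\int[P]_w (g (X n.+1 w))%:E = \int[P]_w (Q g (X n w))%:E)%E.
Proof.
move=> g0.
have Qg0 k : 0 <= Q g k by rewrite QE addr_ge0 // mulr_ge0.
pose code w := pickle (mkseq (X^~ w) n.+1).
pose F k := code @^-1` [set k].
have FE k : F k = set0 \/ exists x, F k = cylinder n x.
  have [->|/set0P[w0 Fw0]] := eqVneq (F k) set0; [by left | right].
  exists (X^~ w0); apply/seteqP; split => w /=.
    move=> Fw i ni; have /(pcan_inj pickleK) E : code w = code w0 by rewrite Fw Fw0.
    by have := congr1 (nth 0 ^~ i) E; rewrite /= !nth_mkseq.
  move=> Hw; rewrite /F /= -Fw0; congr pickle; apply/eq_in_map => i.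
  by rewrite mem_iota add0n ltnS => /andP[_]; exact: Hw.
have mF k : measurable (F k).
  by have [->|[x ->]] := FE k; [exact: measurable0 | exact: measurable_cylinder].
have FT : setT = \bigcup_k F k by apply/seteqP; split => // w _; exists (code w).
have tF : trivIset setT F by exact: trivIset_preimage1.
rewrite FT !ge0_integral_bigcup //; last 2 first.
- by move=> w _; rewrite lee_fin.
- by move=> w _; rewrite lee_fin.
apply: eq_eseriesr => k _.
have [->|[x ->]] := FE k; first by rewrite !integral_set0.
exact: cylinder_integral_step.
Qed.

(** One step of the chain adds exactly 1 to the expectation. The induction runs on integrals of
    nonnegative functions, so integrability of [f (X n)] is a consequence and not a premise. *)
Lemma expected_potential (f : int -> R) : (forall k, 0 <= f k) ->
  f x0 = 0 -> (forall k, Q f k = f k + 1) ->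
  forall n, (\int[P]_w (f (X n w))%:E = n%:R%:E)%E.
Proof.
move=> f0 fx0 Qf; elim=> [|n IH]; last first.
  rewrite chain_integral_step //.
  under eq_integral do rewrite Qf -[f _]mul1r.
  rewrite (integral_affine (fun w => f (X n w)) 1 1) //.
    by rewrite IH mul1e -EFinD natr1.
  exact: measurable_chain_fun.
have [_ PX0 _] := mcX.
have PN0 : P (~` (X 0%N @^-1` [set x0])) = 0%E.
  by rewrite probability_setC ?[X in (_ - X)%E]PX0 ?subee //; exact: mX.
rewrite -[RHS](integral0 P setT); apply: ge0_ae_eq_integral => //.
  by move=> w _; rewrite lee_fin.
exists (~` (X 0%N @^-1` [set x0])); split.
- exact/measurableC/mX.
- exact: PN0.
- by move=> w /= H E; apply: H => _; rewrite E fx0.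
Qed.

End NearestNeighbourChain.

(** The upper bounds also give finiteness of each [E n]. For [v = 0] the lower condition is empty
    and [E n >= 0] replaces it. *)
Lemma cvg_ratio (R : realType) (E : nat -> \bar R) (v : R) :
  0 <= v -> (forall n, 0 <= E n)%E ->
  (forall s : R, v < s -> exists C : R, forall n, (E n <= (s * n%:R + C)%:E)%E) ->
  (forall s : R, 0 < s -> s < v ->
     exists C : R, forall n, ((s * n%:R)%:E <= E n + C%:E)%E) ->
  ((E n * (n%:R^-1)%:E)%E @[n --> \oo]) --> v%:E.
Proof.
move=> v0 E0 up lo.
have Ef n : E n \is a fin_num.
  have [C HC] := up (v + 1) ltac:(lra).
  by rewrite ge0_fin_numE //; apply: le_lt_trans (HC n) (ltry _).
pose x n := fine (E n).
have Ex n : E n = (x n)%:E by rewrite fineK.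
have x0 n : 0 <= x n by rewrite fine_ge0.
rewrite (_ : (fun n => _) = EFin \o (fun n => x n / n%:R)); last first.
  by apply/funext => n /=; rewrite Ex -EFinM.
apply: cvg_EFin; first by apply: nearW.
apply/cvgrPdist_le => /= e e0.
have e2 : 0 < e / 2 by rewrite divr_gt0.
have [C HC] := up (v + e / 2) ltac:(lra).
(* If [v - e / 2 <= 0], the bound follows from nonnegativity alone. *)
have [D HD] : exists D : R, forall n, (v - e / 2) * n%:R <= x n + D.
  have [v2|v2] := ltP 0 (v - e / 2).
    have [D HD] := lo (v - e / 2) v2 ltac:(lra).
    by exists D => n; have := HD n; rewrite Ex -EFinD lee_fin.
  by exists 0 => n; rewrite addr0 (le_trans _ (x0 n)) // mulr_le0_ge0.
have {}HC n : x n <= (v + e / 2) * n%:R + C by rewrite -lee_fin -Ex.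
near=> n.
have n0 : 0 < n%:R :> R by rewrite ltr0n; near: n; exact: nbhs_infty_gt.
have nB : (`|C| + `|D|) / (e / 2) <= n%:R.
  by near: n; exact: nbhs_infty_ger.
move: nB; rewrite ler_pdivrMr // => nB.
have -> : v - x n / n%:R = (v * n%:R - x n) / n%:R by field; rewrite gt_eqF.
rewrite normrM normfV (gtr0_norm n0) ler_pdivrMr // ler_norml.
have := HC n; have := HD n; have := ler_norm C; have := ler_norm D.
have := normr_ge0 C; have := normr_ge0 D.
by move=> ? ? ? ? ? ?; apply/andP; split; lra.
Unshelve. all: by end_near. Qed.

(** * The potential on the whole lattice *)

Section LatticePotential.
Variable R : realType.
Implicit Types (u : nat -> R) (kappa : int -> R).

(** Edge [k, k+1] carries [kappa k], so the edges met going left from 0 are exactly [Negz 0],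
    [Negz 1], ..., and the site [Negz n] lies behind [n.+1] of them. *)
Definition lattice_potential kappa (k : int) : R :=
  match k with
  | Posz n => walk_potential (fun j => kappa (Posz j)) n
  | Negz n => walk_potential (fun j => kappa (Negz j)) n.+1
  end.

Lemma lattice_potential_ge0 kappa k : (forall j, 0 < kappa j) ->
  0 <= lattice_potential kappa k.
Proof. by move=> kap0; case: k => n; exact: walk_potential_ge0. Qed.

Lemma lattice_potential0 kappa : lattice_potential kappa 0 = 0.
Proof. by rewrite /= /walk_potential big_ord0. Qed.

Lemma walk_potentialS u n : walk_potential u n.+1 =
  walk_potential u n + (1 + 2 * ((u n)^-1 * \sum_(i < n) u i)).
Proof. by rewrite /walk_potential big_ord_recr. Qed.

(** The flux through edge [j] is [u j] plus twice the sum of the earlier conductances, so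
    consecutive fluxes differ by [u n.+1 + u n]. *)
Lemma walk_potential_balance u n : (forall j, 0 < u j) ->
  u n * walk_potential u n + u n.+1 * walk_potential u n.+2 =
  (u n.+1 + u n) * (walk_potential u n.+1 + 1).
Proof.
move=> u0; rewrite (walk_potentialS u n.+1) (walk_potentialS u n) big_ord_recr /=.
by field; rewrite !gt_eqF.
Qed.

Lemma lattice_potential_balance kappa k : (forall j, 0 < kappa j) ->
  kappa (k - 1) * lattice_potential kappa (k - 1)
  + kappa k * lattice_potential kappa (k + 1) =
  (kappa k + kappa (k - 1)) * (lattice_potential kappa k + 1).
Proof.
move=> kap0; case: k => [[|n]|n].
(* At the origin the two half-lines meet, and both neighbours have potential 1. *)
- rewrite sub0r add0r (_ : - 1 = Negz 0) // (_ : 1 = Posz 1) //=.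
  by rewrite !walk_potentialS /walk_potential !big_ord0 !mulr0; ring.
- rewrite (_ : Posz n.+1 - 1 = Posz n); last by lia.
  rewrite (_ : Posz n.+1 + 1 = Posz n.+2); last by lia.
  exact: walk_potential_balance.
- rewrite (_ : Negz n - 1 = Negz n.+1); last by lia.
  have -> : lattice_potential kappa (Negz n + 1) =
            walk_potential (fun j => kappa (Negz j)) n.
    case: n => [|n]; last by rewrite (_ : Negz n.+1 + 1 = Negz n) //; lia.
    by rewrite (_ : Negz 0 + 1 = 0) //= /walk_potential !big_ord0.
  rewrite addrC [X in _ = X * _]addrC.
  exact: (walk_potential_balance (fun j => kappa (Negz j))).
Qed.

Lemma lattice_growth_upper kappa a b (s : R) : (forall j, 0 < kappa j) ->
  has_mean (fun j => kappa (Posz j)) a ->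
  has_mean (fun j => (kappa (Posz j))^-1) b ->
  has_mean (fun j => kappa (Negz j)) a ->
  has_mean (fun j => (kappa (Negz j))^-1) b ->
  0 < s -> s * (a * b) < 1 ->
  exists2 C : R, 0 <= C &
    forall k : int, s * lattice_potential kappa k <= k%:~R ^+ 2 + C.
Proof.
move=> kap0 pa pb na nb s0 sab.
(* Chosen so that [s * (a * b + e) = 1]: the coefficient of [k^2] becomes exactly 1. *)
pose e := s^-1 - a * b.
have e0 : 0 < e.
  by rewrite subr_gt0 -(ltr_pM2l s0) divff // gt_eqF.
have [C HC] := walk_potential_growth _ _ _ _ (fun j => kap0 (Posz j)) pa pb _ e0.
have [D HD] := walk_potential_growth _ _ _ _ (fun j => kap0 (Negz j)) na nb _ e0.
have bound (w n E : R) : `|w - a * b * n ^+ 2| <= e * n ^+ 2 + E ->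
    s * w <= n ^+ 2 + s * E.
  move=> /ler_normlW; rewrite lerBlDr => H.
  apply: (le_trans (ler_wpM2l (ltW s0) H)).
  rewrite le_eqVlt; apply/orP; left; apply/eqP; rewrite /e.
  by field; rewrite gt_eqF.
exists (s * (`|C| + `|D|)); first by rewrite mulr_ge0 ?addr_ge0 // ltW.
have CD := ler_wpM2l (ltW s0) (ler_norm C).
have DD := ler_wpM2l (ltW s0) (ler_norm D).
have C0 := mulr_ge0 (ltW s0) (normr_ge0 C).
have D0 := mulr_ge0 (ltW s0) (normr_ge0 D).
case=> n.
  by have := bound _ _ _ (HC n); rewrite /= -pmulrn; lra.
rewrite NegzE mulrNz sqrrN.
by have := bound _ _ _ (HD n.+1); rewrite /= -pmulrn; lra.
Qed.

Lemma lattice_growth_lower kappa (v r : int -> R) a b (s : R) :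
  (forall j, 0 < kappa j) ->
  (forall j, 0 <= v j <= kappa j) -> (forall j, 0 <= r j <= (kappa j)^-1) ->
  has_mean (fun j => v (Posz j)) a -> has_mean (fun j => r (Posz j)) b ->
  has_mean (fun j => v (Negz j)) a -> has_mean (fun j => r (Negz j)) b ->
  0 < s -> 1 < s * (a * b) ->
  exists2 C : R, 0 <= C &
    forall k : int, k%:~R ^+ 2 <= s * lattice_potential kappa k + C.
Proof.
move=> kap0 vk rk pa pb na nb s0 sab.
(* Symmetric choice: [s * (a * b - e) = 1]. *)
pose e := a * b - s^-1.
have e0 : 0 < e.
  by rewrite subr_gt0 -(ltr_pM2l s0) divff // gt_eqF.
have [C HC] := walk_potential_lower _ _ _ _ _ _ (fun j => kap0 (Posz j))
  (fun j => vk (Posz j)) (fun j => rk (Posz j)) pa pb _ e0.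
have [D HD] := walk_potential_lower _ _ _ _ _ _ (fun j => kap0 (Negz j))
  (fun j => vk (Negz j)) (fun j => rk (Negz j)) na nb _ e0.
have bound (w n E : R) : (a * b - e) * n ^+ 2 <= w + E ->
    n ^+ 2 <= s * w + s * E.
  move=> /(ler_wpM2l (ltW s0)).
  by rewrite /e subKr mulrA divff ?gt_eqF // mul1r mulrDr.
exists (s * (`|C| + `|D|)); first by rewrite mulr_ge0 ?addr_ge0 // ltW.
have CD := ler_wpM2l (ltW s0) (ler_norm C).
have DD := ler_wpM2l (ltW s0) (ler_norm D).
have C0 := mulr_ge0 (ltW s0) (normr_ge0 C).
have D0 := mulr_ge0 (ltW s0) (normr_ge0 D).
case=> n.
  by have := bound _ _ _ (HC n); rewrite /= -pmulrn; lra.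
rewrite NegzE mulrNz sqrrN.
by have := bound _ _ _ (HD n.+1); rewrite /= -pmulrn; lra.
Qed.

End LatticePotential.

Arguments lattice_potential {R} kappa k.

(** * From potential growth to the second moment in a fixed environment *)

Section QuenchedLimit.
Variables (R : realType) (A : Type) (T Tinv : A -> A) (c : A -> R) (omega : A).
Hypothesis TK : cancel T Tinv.
Hypothesis c_gt0 : forall x, 0 < c x.
Let kappa k := c (iterz T Tinv k omega).

Lemma iterz_pred k : Tinv (iterz T Tinv k omega) = iterz T Tinv (k - 1) omega.
Proof.
case: k => [[|n]|n] //.
- by rewrite (_ : Posz n.+1 - 1 = Posz n); [rewrite /= TK | lia].
- by rewrite (_ : Negz n - 1 = Negz n.+1) //; lia.
Qed.

Lemma walk_operatorE f k : walk_operator T Tinv c omega f k =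
  kappa (k - 1) / (kappa k + kappa (k - 1)) * f (k - 1)
  + kappa k / (kappa k + kappa (k - 1)) * f (k + 1).
Proof.
rewrite /walk_operator /cbar iterz_pred -!/(kappa _).
have kap0 j : 0 < kappa j by exact: c_gt0.
by field; rewrite gt_eqF // addr_gt0.
Qed.

(** As the potential has expectation [n], integrating a comparison of slope [s] bounds the second
    moment by [s * n] up to a constant. Only these comparisons determine [v], so finite and infinite
    integrals are treated alike. *)
Lemma quenched_limit (v : R) : 0 <= v ->
  (forall s : R, v < s -> exists2 C : R, 0 <= C &
    forall k : int, k%:~R ^+ 2 <= s * lattice_potential kappa k + C) ->
  (forall s : R, 0 < s -> s < v -> exists2 C : R, 0 <= C &
    forall k : int, s * lattice_potential kappa k <= k%:~R ^+ 2 + C) ->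
  forall (d : measure_display) (W : measurableType d) (P : probability W R)
    (X : nat -> W -> int),
  markov_chain P (walk_operator T Tinv c omega) 0 X ->
  (('E_P[(fun w : W => (X n w)%:~R ^+ 2 : R)%R] * (n%:R^-1)%:E)%E
     @[n --> \oo]) --> v%:E.
Proof.
move=> v0 lo up d W P X mcX.
have kap0 j : 0 < kappa j by exact: c_gt0.
have kk0 k : 0 < kappa k + kappa (k - 1) by rewrite addr_gt0.
have f0 k : 0 <= lattice_potential kappa k by exact: lattice_potential_ge0.
have mX g n : measurable_fun setT (fun w => g (X n w) : R).
  exact: measurable_chain_fun mcX g n.
have Ef n : (\int[P]_w (lattice_potential kappa (X n w))%:E = n%:R%:E)%E.
  apply: (expected_potential _ _ _ P _ _ _ walk_operatorE _ _ _ 0 X mcX) => //.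
  - by move=> k; rewrite divr_ge0 // ltW.
  - by move=> k; rewrite divr_ge0 // ltW.
  - by move=> k; rewrite -mulrDl [X in X / _]addrC divff // gt_eqF.
  - exact: lattice_potential0.
  - move=> k; rewrite walk_operatorE mulrAC [X in _ + X]mulrAC -mulrDl.
    by rewrite lattice_potential_balance // mulrAC divff ?mul1r // gt_eqF.
rewrite (_ : (fun n => _) =
  fun n => (\int[P]_w ((X n w)%:~R ^+ 2)%:E * (n%:R^-1)%:E)%E); last first.
  by apply/funext => n; rewrite unlock.
have X0 n w : 0 <= (X n w)%:~R ^+ 2 :> R by exact: sqr_ge0.
apply: cvg_ratio => //.
- by move=> n; apply: integral_ge0 => w _; rewrite lee_fin.
- move=> s vs; have [C C0 HC] := lo s vs; have s0 := le_lt_trans v0 vs.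
  exists C => n; rewrite EFinD EFinM -Ef.
  rewrite -(integral_affine _ _ _ P
    (fun w => lattice_potential kappa (X n w)) s C) //; last exact: ltW.
  apply: ge0_le_integral => //.
  + by move=> w _; rewrite lee_fin.
  + exact/measurable_EFinP/(mX (fun k => k%:~R ^+ 2)).
  + exact/measurable_EFinP/(mX (fun k => s * lattice_potential kappa k + C)).
  + by move=> w _; rewrite lee_fin.
- move=> s s0 sv; have [C C0 HC] := up s s0 sv; exists C => n.
  rewrite -[X in (_ <= X + _)%E]mul1e.
  rewrite -(integral_affine _ _ _ P (fun w => (X n w)%:~R ^+ 2) 1 C) //; last first.
    exact: (mX (fun k => k%:~R ^+ 2)).
  rewrite EFinM -Ef -[X in (X <= _)%E]adde0.
  rewrite -(integral_affine _ _ _ P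
    (fun w => lattice_potential kappa (X n w)) s 0) //; last exact: ltW.
  apply: ge0_le_integral => //.
  + by move=> w _; rewrite lee_fin addr0 mulr_ge0 // ltW.
  + exact/measurable_EFinP/(mX (fun k => s * lattice_potential kappa k + 0)).
  + exact/measurable_EFinP/(mX (fun k => 1 * k%:~R ^+ 2 + C)).
  + by move=> w _; rewrite lee_fin addr0 mul1r.
Qed.

End QuenchedLimit.

(** * Bounded truncations of a positive random variable *)

Section Truncation.
Variables (R : realType) (d : measure_display) (Omega : measurableType d).
Variables (mu : probability Omega R) (h : Omega -> R).
Hypothesis mh : measurable_fun setT h.
Hypothesis h_gt0 : forall x, 0 < h x.

(** The cut-off [M.+1] keeps the truncation positive already at [M = 0]. *)
Definition truncation (M : nat) (x : Omega) : R := Num.min (h x) M.+1%:R.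

Definition truncated_mean (M : nat) : R := fine (\int[mu]_x (truncation M x)%:E).

Lemma truncation_gt0 M x : 0 < truncation M x.
Proof. by rewrite lt_min h_gt0 ltr0n. Qed.

Lemma truncation_le M x : 0 <= truncation M x <= h x.
Proof. by rewrite ltW ?truncation_gt0 // /truncation ge_min lexx. Qed.

Lemma measurable_truncation M : measurable_fun setT (truncation M).
Proof. exact: measurable_minr. Qed.

Lemma integrable_truncation M : mu.-integrable setT (EFin \o truncation M).
Proof.
apply: (le_integrable measurableT (g := EFin \o cst M.+1%:R)).
- exact/measurable_EFinP/measurable_truncation.
- move=> x _; rewrite /= lee_fin (gtr0_norm (truncation_gt0 M x)) ger0_norm //.
  by rewrite /truncation ge_min lexx orbT.
- exact: finite_measure_integrable_cst.
Qed.

Lemma integral_truncation M :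
  (\int[mu]_x (truncation M x)%:E = (truncated_mean M)%:E)%E.
Proof.
by rewrite fineK //; exact: (integrable_fin_num measurableT (integrable_truncation M)).
Qed.

(** Monotone convergence with values in the extended reals, so that an infinite integral is
    included. *)
Lemma truncated_mean_cvg :
  (truncated_mean M)%:E @[M --> \oo] --> (\int[mu]_x (h x)%:E)%E.
Proof.
under eq_fun do rewrite -integral_truncation.
rewrite (_ : \int[mu]_x (h x)%:E =
  \int[mu]_x (limn (fun M => (truncation M x)%:E)))%E; last first.
  apply: eq_integral => x _; apply/esym/cvg_lim => //.
  apply: cvg_near_cst; exists (Num.trunc (h x)) => // M /= hM; congr EFin.
  apply/min_idPl; apply: le_trans (ltW (truncnS_gt _)) _.
  by rewrite ler_nat ltnS.
apply: (cvg_monotone_convergence measurableT) => //.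
- by move=> M; exact/measurable_EFinP/measurable_truncation.
- by move=> M x _; rewrite lee_fin ltW // truncation_gt0.
- move=> x _ M N MN; rewrite lee_fin /truncation le_min ge_min lexx /= ge_min.
  by rewrite ler_nat ltnS MN orbT.
Qed.

(** A zero integral would make [h] vanish almost everywhere, so the whole space would be null.
    Positivity excludes the form [0 * +oo] in the product of the two integrals. *)
Lemma integral_pos_gt0 : (0 < \int[mu]_x (h x)%:E)%E.
Proof.
rewrite lt_neqAle integral_ge0 ?andbT; last by move=> x _; rewrite lee_fin ltW.
apply/eqP => /esym h0.
have : (\int[mu]_x `|(h x)%:E| = 0)%E.
  by rewrite -[RHS]h0; apply: eq_integral => x _; rewrite gee0_abs // lee_fin ltW.
have mEh : measurable_fun setT (EFin \o h) by exact/measurable_EFinP.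
move/(ae_eq_integral_abs mu measurableT mEh) => -[N [mN N0 hN]].
have NT : N = setT.
  apply/seteqP; split => // x _; apply: hN => /= /(_ I) [] hx0.
  by have := h_gt0 x; rewrite hx0 ltxx.
have : mu N = 1%E by rewrite NT; exact: probability_setT.
by move=> N1; have : (mu N = 0)%E by []; rewrite N1 => /eqP; rewrite onee_eq0.
Qed.

End Truncation.

Arguments truncation {R d Omega} h M x.
Arguments truncated_mean {R d Omega} mu h M.

(** * Ergodic means along both half-orbits *)

Section TwoSidedMeans.
Variables (R : realType) (d : measure_display) (Omega : measurableType d).
Variables (mu : probability Omega R) (T Tinv : Omega -> Omega).
Hypothesis T_inv : invertible_transformation T Tinv.
Hypothesis T_mp : measure_preserving mu T.
Hypothesis T_erg : ergodic mu T.

Lemma measure_preserving_inverse : measure_preserving mu Tinv.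
Proof.
have [TK KT mT mTinv] := T_inv => A mA; rewrite -[LHS]T_mp.
  congr (mu _); apply/funext => x; rewrite /preimage /=; apply/propeqP.
  by rewrite TK.
by rewrite -[X in measurable X]setTI; exact: mTinv.
Qed.

Lemma ergodic_inverse : ergodic mu Tinv.
Proof.
have [TK KT mT mTinv] := T_inv => A mA AI; apply: T_erg => //.
rewrite -{1}AI; apply/funext => x; rewrite /preimage /=; apply/propeqP.
by rewrite TK.
Qed.

Lemma birkhoff_two_sided (g : Omega -> R) (a : R) :
  mu.-integrable setT (EFin \o g) -> (\int[mu]_x (g x)%:E = a%:E)%E ->
  \forall x \ae mu,
    has_mean (fun j => g (iterz T Tinv (Posz j) x)) a /\
    has_mean (fun j => g (iterz T Tinv (Negz j) x)) a.
Proof.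
have [TK KT mT mTinv] := T_inv => gi ga.
have Ip := integrable_preserving _ _ _ _ _ mTinv measure_preserving_inverse.
have Ep := integral_preserving _ _ _ _ _ mTinv measure_preserving_inverse.
have P := birkhoff_mean _ _ _ mu _ mT T_mp T_erg g a gi ga.
(* The left half-orbit starts at [Tinv x], because [Negz j] stands for [j.+1] backward steps; hence
   the theorem is applied to [g \o Tinv]. *)
have gTa : (\int[mu]_x (g (Tinv x))%:E = a%:E)%E by rewrite -ga -(Ep _ gi).
have N := birkhoff_mean _ _ _ mu _ mTinv measure_preserving_inverse
  ergodic_inverse (g \o Tinv) a (Ip _ gi) gTa.
by move: P N; apply: filterS2.
Qed.

End TwoSidedMeans.

(** * Choice of the exceptional null set and identification of the limit *)

Theorem mainTheorem1 (R : realType) (d : measure_display)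
    (Omega : measurableType d) (mu : probability Omega R)
    (T Tinv : Omega -> Omega) (c : {RV mu >-> R})
    (T_inv : invertible_transformation T Tinv)
    (T_mp : measure_preserving mu T)
    (T_erg : ergodic mu T)
    (c_gt0 : forall omega : Omega, 0 < c omega) :
  \forall omega \ae mu,
    forall (d' : measure_display) (W : measurableType d')
      (P : probability W R) (X : nat -> W -> int),
      markov_chain P (walk_operator T Tinv c omega) 0 X ->
      (('E_P[(fun w : W => (X n w)%:~R ^+ 2 : R)%R] * (n%:R^-1)%:E)%E
         @[n --> \oo]) --> limit_variance mu c.
Proof.
pose r omega := (c omega)^-1.
have mc : measurable_fun setT c by [].
have r_gt0 omega : 0 < r omega by rewrite invr_gt0.
have mr : measurable_fun setT r.
  rewrite (_ : r = (fun x => x `^ (- 1)) \o c); last first.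
    by apply/funext => x /=; rewrite powR_inv1 // ltW.
  by apply: measurableT_comp => //; exact: measurable_powR.
have [TK _ _ _] := T_inv.
pose two_sided (g : Omega -> R) a omega :=
  has_mean (fun j => g (iterz T Tinv (Posz j) omega)) a /\
  has_mean (fun j => g (iterz T Tinv (Negz j) omega)) a.
have trunc_ae (h : Omega -> R) (mh : measurable_fun setT h)
    (h0 : forall x, 0 < h x) :
    \forall omega \ae mu, forall M,
      two_sided (truncation h M) (truncated_mean mu h M) omega.
  apply: ae_foralln => M; apply: birkhoff_two_sided => //.
  - exact: integrable_truncation.
  - exact: integral_truncation.
have fin_ae (h : Omega -> R) (mh : measurable_fun setT h)
    (h0 : forall x, 0 < h x) :
    \forall omega \ae mu, (\int[mu]_x (h x)%:E)%E \is a fin_num ->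
      two_sided h (fine (\int[mu]_x (h x)%:E)) omega.
  have [hf|hf] := boolP ((\int[mu]_x (h x)%:E)%E \is a fin_num); last first.
    by apply: aeW.
  have hi : mu.-integrable setT (EFin \o h).
    apply/integrableP; split; first exact/measurable_EFinP.
    under eq_integral do rewrite gee0_abs ?lee_fin ?(ltW (h0 _)) //.
    by rewrite ltey_eq hf.
  have := birkhoff_two_sided R d Omega mu T Tinv T_inv T_mp T_erg h _ hi.
  move=> /(_ (fine (\int[mu]_x (h x)%:E)%E)); rewrite fineK // => /(_ erefl).
  by apply: filterS => omega H _.
have c_pos := integral_pos_gt0 R d Omega mu c mc c_gt0.
have r_pos := integral_pos_gt0 R d Omega mu r mr r_gt0.
set I := (\int[mu]_x (c x)%:E)%E in c_pos.
set J := (\int[mu]_x (r x)%:E)%E in r_pos.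
(* These two conditions cover every case: if an integral is infinite then [v = 0], the product
   [I * J] is [+oo], and the second condition is vacuous. *)
have [v [v0 vE lo up]] : exists v : R, [/\ 0 <= v, limit_variance mu c = v%:E,
    (forall s : R, v < s -> ((s^-1)%:E < I * J)%E) &
    (forall s : R, 0 < s -> s < v -> [/\ I \is a fin_num, J \is a fin_num &
       s * (fine I * fine J) < 1])].
  rewrite /limit_variance -/I -/(r _) -/J.
  case: ifPn => [IJ|].
    exists 0; split => //; last by move=> s s0 /(lt_trans s0); rewrite ltxx.
    move=> s s0; rewrite (_ : (I * J)%E = +oo%E) ?ltry //.
    case/orP: IJ => /eqP ->; first by rewrite gt0_mulye.
    by rewrite gt0_muley.
  rewrite negb_or => /andP[Iy Jy].
  have If : I \is a fin_num by rewrite ge0_fin_numE ?lt_neqAle ?leey ?andbT // ltW.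
  have Jf : J \is a fin_num by rewrite ge0_fin_numE ?lt_neqAle ?leey ?andbT // ltW.
  have i0 : 0 < fine I by rewrite fine_gt0 // c_pos ltey_eq If.
  have j0 : 0 < fine J by rewrite fine_gt0 // r_pos ltey_eq Jf.
  have ij0 := mulr_gt0 i0 j0.
  have IJE : (I * J = (fine I * fine J)%:E)%E by rewrite EFinM !fineK.
  exists (fine I * fine J)^-1; rewrite IJE; split.
  - by rewrite invr_ge0 ltW.
  - by rewrite inver gt_eqF.
  - move=> s vs; rewrite lte_fin -[ltRHS]invrK ltf_pV2 ?posrE ?invr_gt0 //.
    by apply: lt_trans vs; rewrite invr_gt0.
  - move=> s s0 sv; split => //.
    by rewrite -ltr_pdivlMr // div1r.
rewrite vE.
have cE := trunc_ae c mc c_gt0; have rE := trunc_ae r mr r_gt0.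
have cF := fin_ae c mc c_gt0; have rF := fin_ae r mr r_gt0.
(* The exceptional set is fixed here, before the probability space and the chain are introduced. *)
apply: filterS2 (filterI cE rE) (filterI cF rF) => omega [{}cE {}rE] [{}cF {}rF].
move=> d' W P X mcX.
apply: (quenched_limit R Omega T Tinv c omega TK c_gt0 v v0 _ _ _ _ _ _ mcX).
- move=> s vs; have s0 := le_lt_trans v0 vs.
  (* The products of truncated means tend to [I * J], which exceeds [s^-1], so some truncation level
     already does. *)
  have [M sM] :
      exists M, s^-1 < truncated_mean mu c M * truncated_mean mu r M.
    apply: contrapT => /forallNP nM.
    have := lo s vs; rewrite ltNge => /negP; apply.
    have cvgIJ : (truncated_mean mu c M * truncated_mean mu r M)%:E
        @[M --> \oo] --> (I * J)%E.
      under eq_fun do rewrite EFinM.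
      apply: cvgeM; [|exact: truncated_mean_cvg|exact: truncated_mean_cvg].
      by apply: neq0_mule_def; rewrite mule_neq0 // gt_eqF.
    rewrite -(cvg_lim _ cvgIJ) //; apply: lime_le.
      by apply/cvg_ex; exists (I * J)%E.
    by apply: nearW => M; rewrite lee_fin leNgt; apply/negP; exact: nM.
  have [cp cn] := cE M; have [rp rn] := rE M.
  apply: (lattice_growth_lower R _
    (fun k => truncation c M (iterz T Tinv k omega))
    (fun k => truncation r M (iterz T Tinv k omega))
    _ _ _ _ _ _ cp rp cn rn) => //.
  + by move=> k; exact: truncation_le.
  + by move=> k; exact: truncation_le.
  + by rewrite -ltr_pdivrMl // mulr1.
- move=> s s0 sv; have [If Jf sIJ] := up s s0 sv.
  have [cp cn] := cF If; have [rp rn] := rF Jf.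
  exact: lattice_growth_upper cp rp cn rn s0 sIJ.
Qed.
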